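(* For every loop $F$ and every abelian group $A$, there is a bijection between $\mathbf{Q}(F,A)$ and the set of orbits of the group $\mathrm{Aut}^{*}(F,A)$ acting on the set $C(F,A)$ of normalized cocycles.
   Context: A loop is a set with a binary operation having a two-sided neutral element $1$ such that all left and right translations are bijective. The center $Z(L)$ of a loop $L$ is the set of elements that commute and associate with all elements of $L$; every subloop of $Z(L)$ is normal in $L$. Abelian groups $A$ are written additively; maps are written as exponents ($x^{\alpha}$), and products of maps are composed from left to right ($x^{\alpha\alpha'}=(x^{\alpha})^{\alpha'}$). For pairs $(L_1,A_1)$, $(L_2,A_2)$ with $A_i\le L_i$ a subloop, an isomorphism is a loop isomorphism $f:L_1\to L_2$ with $f(A_1)=A_2$; $[L,A]$ denotes the isomorphism class of $(L,A)$. $\mathbf{Q}(F,A)$ is the set of isomorphism classes of pairs consisting of a loop $L$ and a subloop of $Z(L)$ isomorphic to $A$ (again denoted $A$) such that $L/A\cong F$. $C(F,A)$ is the set of normalized cocycles, i.e. functions $\theta:F\times F\to A$ with $\theta(1,x)=\theta(x,1)=0$ for all $x\in F$; it is an abelian group under pointwise addition. $\mathrm{Aut}^{*}(F,A)$ is the group of all triples $(\alpha,\beta,\tau)$ with $\alpha\in\mathrm{Aut}(F)$, $\beta\in\mathrm{Aut}(A)$ and $\tau:F\to A$ a map with $\tau(1)=0$, with multiplication $(\alpha,\beta,\tau)(\alpha',\beta',\tau')=(\alpha\alpha',\beta\beta',\alpha\tau'+\tau\beta')$, where $(\alpha\tau')(x)=\tau'(x^{\alpha})$ and $(\tau\beta')(x)=(\tau(x))^{\beta'}$.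 It acts on $C(F,A)$ from the right by $$\theta^{(\alpha,\beta,\tau)}(x,y)=\theta(x^{\alpha^{-1}},y^{\alpha^{-1}})^{\beta}+\tau((xy)^{\alpha^{-1}})-\tau(x^{\alpha^{-1}})-\tau(y^{\alpha^{-1}}).$$ *)

(* Defs.v *)
From HB Require Import structures.
From mathcomp Require Import all_boot all_algebra.
From mathcomp Require Import boolp classical_sets functions.

Set Implicit Arguments.
Unset Strict Implicit.
Unset Printing Implicit Defensive.

Import GRing.Theory.
Local Open Scope classical_set_scope.
Local Open Scope group_scope.

HB.mixin Record UMagma_isLoop L of UMagma L := {
  lmul_bij : forall x : L, bijective (fun y : L => x * y);
  rmul_bij : forall x : L, bijective (fun y : L => y * x)
}.

#[short(type="loopType")]
HB.structure Definition Loop := { L of UMagma_isLoop L & UMagma L }.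

Definition loop_iso (L1 L2 : loopType) (f : L1 -> L2) : Prop :=
  bijective f /\ {morph f : x y / x * y}.

(* The last two fields are closure under the two divisions. *)
Record subloop (L : loopType) := Subloop {
  subloop_set :> set L;
  subloop1 : subloop_set 1;
  subloopM : forall x y, subloop_set x -> subloop_set y -> subloop_set (x * y);
  subloop_ldiv : forall x y,
    subloop_set x -> subloop_set (x * y) -> subloop_set y;
  subloop_rdiv : forall x y,
    subloop_set x -> subloop_set (y * x) -> subloop_set y
}.

Definition loop_center (L : loopType) : set L :=
  [set z | forall x y : L,
    [/\ z * x = x * z, z * (x * y) = (z * x) * y,
        x * (z * y) = (x * z) * y & x * (y * z) = (x * y) * z]].
Arguments loop_center : clear implicits.

Lemma bij_of_inj_surj (T : Type) (f : T -> T) :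
  injective f -> (forall y, exists x, f x = y) -> bijective f.
Proof.
move=> fI fS; pose g y := projT1 (cid (fS y)).
have fK y : f (g y) = y by exact: projT2 (cid (fS y)).
by exists g => // x; apply: fI; rewrite fK.
Qed.

Lemma inj_image_inj (T : Type) (f : T -> T) (X Y : T -> Prop) :
  injective f -> [set f z | z in X] = [set f z | z in Y] -> X = Y.
Proof.
move=> fI e; apply/funext => z; apply/propext; split=> hz.
  have: [set f z | z in Y] (f z) by rewrite -e; exists z.
  by case=> w Yw /fI <-.
have: [set f z | z in X] (f z) by rewrite e; exists z.
by case=> w Xw /fI <-.
Qed.

Section Quotient.
Context (L : loopType).
Implicit Types (N : subloop L) (x y : L) (X Y : L -> Prop).

Definition loop_lcoset N x : L -> Prop := [set x * n | n in N].
Definition loop_rcoset N x : L -> Prop := [set n * x | n in N].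

Definition normal_subloop N : Prop := forall x y,
  [/\ loop_lcoset N x = loop_rcoset N x,
      [set x * z | z in loop_lcoset N y] = loop_lcoset N (x * y) &
      [set z * y | z in loop_rcoset N x] = loop_rcoset N (x * y)].

Lemma central_normal N : N `<=` loop_center L -> normal_subloop N.
Proof.
move=> cN x y; split; apply/seteqP; split=> z /=.
- by case=> n Nn <-; exists n => //; have [-> _ _ _] := cN n Nn x y.
- by case=> n Nn <-; exists n => //; have [-> _ _ _] := cN n Nn x y.
- case=> _ [n Nn <-] <-; exists n => //.
  by have [_ _ _ ->] := cN n Nn x y.
- case=> n Nn <-; exists (y * n); first by exists n.
  by have [_ _ _ ->] := cN n Nn x y.
- case=> _ [n Nn <-] <-; exists n => //.
  by have [_ -> _ _] := cN n Nn x y.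
- case=> n Nn <-; exists (n * x); first by exists n.
  by have [_ -> _ _] := cN n Nn x y.
Qed.

(* The carrier of L / N; cosets are multiplied as subsets of L. *)
Record loop_quotient N (nN : normal_subloop N) := LoopCoset {
  coset_set : L -> Prop;
  coset_setP : exists x, coset_set = loop_lcoset N x
}.

Definition mul_subsets X Y : L -> Prop := [set x * y | x in X & y in Y].

Section NormalSubloop.
Context N (nN : normal_subloop N).

Lemma loop_lcosetE x n :
  subloop_set N n -> loop_lcoset N (x * n) = loop_lcoset N x.
Proof.
move=> Nn; have [_ <- _] := nN x n; apply/seteqP; split=> z /=.
  by case=> _ [m Nm <-] <-; exists (n * m) => //; apply: subloopM.
case=> m Nm <-; exists m => //; have [g gK Kg] := lmul_bij n.
exists (g m); last exact: Kg.
by apply: (subloop_ldiv Nn); rewrite Kg.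
Qed.

Lemma loop_lcoset_refl x : loop_lcoset N x x.
Proof. by exists 1; [exact: subloop1 | rewrite mulg1]. Qed.

Lemma mul_loop_lcoset x y :
  mul_subsets (loop_lcoset N x) (loop_lcoset N y) = loop_lcoset N (x * y).
Proof.
apply/seteqP; split=> z /=.
  case=> _ [n Nn <-] [_ [m Nm <-] <-].
  have [_ e1 _] := nN x y; have [e2 _ e3] := nN x (y * m).
  have [e4 _ _] := nN (x * (y * m)) 1.
  have: loop_rcoset N (x * (y * m)) (x * n * (y * m)).
    by rewrite -e3; exists (x * n) => //; rewrite -e2; exists n.
  rewrite -e4.
  have: loop_lcoset N (x * y) (x * (y * m)).
    by rewrite -e1; exists (y * m) => //; exists m.
  by case=> k Nk <-; rewrite loop_lcosetE.
have [_ <- _] := nN x y.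
by case=> w Nw <-; exists x; [exact: loop_lcoset_refl | exists w].
Qed.

Definition to_quotient x : loop_quotient nN :=
  LoopCoset nN (ex_intro _ x erefl).

Lemma loop_quotient_inj (u v : loop_quotient nN) :
  coset_set u = coset_set v -> u = v.
Proof.
case: u v => [X hX] [Y hY] /= e; case: Y / e hY => hY.
by congr LoopCoset; apply: Prop_irrelevance.
Qed.

Lemma to_quotient_surj (u : loop_quotient nN) : exists x, u = to_quotient x.
Proof. by have [x e] := coset_setP u; exists x; apply: loop_quotient_inj. Qed.

Fact mul_quotient_subproof (u v : loop_quotient nN) :
  exists x, mul_subsets (coset_set u) (coset_set v) = loop_lcoset N x.
Proof.
have [x ->] := coset_setP u; have [y ->] := coset_setP v.
by exists (x * y); rewrite mul_loop_lcoset.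
Qed.

Definition mul_quotient (u v : loop_quotient nN) : loop_quotient nN :=
  LoopCoset nN (mul_quotient_subproof u v).

Lemma mul_to_quotient x y :
  mul_quotient (to_quotient x) (to_quotient y) = to_quotient (x * y).
Proof. by apply: loop_quotient_inj; rewrite /= mul_loop_lcoset. Qed.

Lemma mul1_quotient : left_id (to_quotient 1) mul_quotient.
Proof.
by move=> u; have [x ->] := to_quotient_surj u; rewrite mul_to_quotient mul1g.
Qed.

Lemma mul_quotient1 : right_id (to_quotient 1) mul_quotient.
Proof.
by move=> u; have [x ->] := to_quotient_surj u; rewrite mul_to_quotient mulg1.
Qed.

Lemma lmul_quotient_bij u : bijective (fun v => mul_quotient u v).
Proof.
have [a ->] := to_quotient_surj u; have [g gK Kg] := lmul_bij a.
apply: bij_of_inj_surj => [v w|v]; last first.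
  have [x ->] := to_quotient_surj v.
  by exists (to_quotient (g x)); rewrite mul_to_quotient Kg.
have [x ->] := to_quotient_surj v; have [y ->] := to_quotient_surj w.
rewrite !mul_to_quotient => /(congr1 (@coset_set _ _)) /= e.
apply: loop_quotient_inj => /=.
have [_ ex _] := nN a x; have [_ ey _] := nN a y.
move: e; rewrite -ex -ey; exact: (inj_image_inj (can_inj gK)).
Qed.

Lemma rmul_quotient_bij u : bijective (fun v => mul_quotient v u).
Proof.
have [a ->] := to_quotient_surj u; have [g gK Kg] := rmul_bij a.
apply: bij_of_inj_surj => [v w|v]; last first.
  have [x ->] := to_quotient_surj v.
  by exists (to_quotient (g x)); rewrite mul_to_quotient Kg.
have [x ->] := to_quotient_surj v; have [y ->] := to_quotient_surj w.
rewrite !mul_to_quotient => /(congr1 (@coset_set _ _)) /= e.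
apply: loop_quotient_inj => /=.
have [ex _ fx] := nN x a; have [ey _ fy] := nN y a.
have [exa _ _] := nN (x * a) 1; have [eya _ _] := nN (y * a) 1.
rewrite ex ey; move: e; rewrite exa eya -fx -fy.
exact: (inj_image_inj (can_inj gK)).
Qed.

HB.instance Definition _ := gen_eqMixin (loop_quotient nN).
HB.instance Definition _ := gen_choiceMixin (loop_quotient nN).
HB.instance Definition _ := hasMul.Build (loop_quotient nN) mul_quotient.
HB.instance Definition _ :=
  Magma_isUMagma.Build (loop_quotient nN) mul1_quotient mul_quotient1.
HB.instance Definition _ :=
  UMagma_isLoop.Build (loop_quotient nN) lmul_quotient_bij rmul_quotient_bij.

End NormalSubloop.
End Quotient.

Record loop_pair := LoopPair {
  pair_loop : loopType;
  pair_sub : subloop pair_loop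
}.

Definition pair_isomorphic (p q : loop_pair) : Prop :=
  exists f : pair_loop p -> pair_loop q,
    loop_iso f /\ f @` pair_sub p = pair_sub q.

(* [L, A]; a predicate rather than a term of type [set loop_pair], since the
   universe of loop_pair lies strictly above that of loopType, which [set] would
   in turn force strictly below that of zmodType. *)
Definition iso_class (p : loop_pair) : loop_pair -> Prop :=
  fun q => pair_isomorphic p q.

Definition subloop_isomorphic_to (A : zmodType) (L : loopType)
    (S : subloop L) : Prop :=
  exists i : A -> L, set_bij setT S i /\ {morph i : a b / (a + b)%R >-> a * b}.

Definition is_central_extension (F : loopType) (A : zmodType)
    (p : loop_pair) : Prop :=
  subloop_isomorphic_to A (pair_sub p) /\
  exists central_p : pair_sub p `<=` loop_center (pair_loop p),
  exists f : loop_quotient (central_normal central_p) -> F, loop_iso f.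

Definition Q (F : loopType) (A : zmodType) : Type :=
  {c : loop_pair -> Prop |
    exists p, is_central_extension F A p /\ c = iso_class p}.

Section Automorphisms.
Context (T : Type) (op : T -> T -> T).

Record automorphism := Automorphism {
  aut_fun :> T -> T;
  aut_inv : T -> T;
  aut_funK : cancel aut_fun aut_inv;
  aut_invK : cancel aut_inv aut_fun;
  aut_morph : {morph aut_fun : x y / op x y}
}.
Implicit Types a b c : automorphism.

Lemma aut_inj a b : a =1 b -> a = b.
Proof.
case: a b => [f f' fK f'K fM] [g g' gK g'K gM] /= e.
have efg : f = g by apply/funext.
case: g / efg gK g'K gM {e} => gK g'K gM.
have ef'g' : f' = g' by apply/funext => x; rewrite -{1}(g'K x) fK.
case: g' / ef'g' gK g'K => gK g'K.
by congr Automorphism; apply: Prop_irrelevance.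
Qed.

Lemma aut_inv_morph a : {morph aut_inv a : x y / op x y}.
Proof.
by move=> x y; apply: (can_inj (aut_funK a)); rewrite aut_morph !aut_invK.
Qed.

Definition aut_id : automorphism :=
  @Automorphism id id (fun=> erefl) (fun=> erefl) (fun _ _ => erefl).

Fact aut_comp_morph a b : {morph b \o a : x y / op x y}.
Proof. by move=> x y /=; rewrite !aut_morph. Qed.

(* Products are composed from left to right. *)
Definition aut_comp a b : automorphism :=
  Automorphism (can_comp (aut_funK b) (aut_funK a))
    (can_comp (aut_invK a) (aut_invK b)) (@aut_comp_morph a b).

Definition aut_opp a : automorphism :=
  Automorphism (aut_invK a) (aut_funK a) (@aut_inv_morph a).

HB.instance Definition _ := gen_eqMixin automorphism.
HB.instance Definition _ := gen_choiceMixin automorphism.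

Fact aut_compA : associative aut_comp.
Proof. by move=> a b c; apply: aut_inj. Qed.
Fact aut_comp1 : left_id aut_id aut_comp.
Proof. by move=> a; apply: aut_inj. Qed.
Fact aut_comp1r : right_id aut_id aut_comp.
Proof. by move=> a; apply: aut_inj. Qed.
Fact aut_compV : left_inverse aut_id aut_opp aut_comp.
Proof. by move=> a; apply: aut_inj => x /=; rewrite aut_invK. Qed.
Fact aut_compVr : right_inverse aut_id aut_opp aut_comp.
Proof. by move=> a; apply: aut_inj => x /=; rewrite aut_funK. Qed.

HB.instance Definition _ := isGroup.Build automorphism
  aut_compA aut_comp1 aut_comp1r aut_compV aut_compVr.

Lemma autK a : cancel a a^-1%g. Proof. exact: aut_funK. Qed.
Lemma autVK a : cancel a^-1%g a. Proof. exact: aut_invK. Qed.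

End Automorphisms.

Definition loop_aut (F : loopType) := automorphism ( *%g : F -> F -> F).
Definition zmod_aut (A : zmodType) := automorphism (+%R : A -> A -> A).
HB.instance Definition _ (F : loopType) := Group.on (loop_aut F).
HB.instance Definition _ (A : zmodType) := Group.on (zmod_aut A).

Lemma loop_aut1 (F : loopType) (a : loop_aut F) : a 1 = 1.
Proof.
apply: (bij_inj (lmul_bij (a 1))) => /=.
by rewrite mulg1 -aut_morph mulg1.
Qed.

Lemma zmod_aut0 (A : zmodType) (b : zmod_aut A) : b 0%R = 0%R.
Proof. by apply: (addIr (b 0%R)); rewrite -aut_morph !add0r. Qed.

Lemma zmod_autN (A : zmodType) (b : zmod_aut A) : {morph b : x / (- x)%R}.
Proof.
move=> x; apply: (addIr (b x)).
by rewrite -aut_morph !addNr zmod_aut0.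
Qed.

Section AutStar.
Context (F : loopType) (A : zmodType).

Record aut_star := AutStar {
  star_alpha : loop_aut F;
  star_beta : zmod_aut A;
  star_tau : F -> A;
  star_tau1 : star_tau 1 = 0%R
}.
Implicit Types g h : aut_star.

Lemma aut_star_inj g h : star_alpha g = star_alpha h ->
  star_beta g = star_beta h -> star_tau g =1 star_tau h -> g = h.
Proof.
case: g h => [a b t t1] [a' b' t' t1'] /= ea eb et.
case: a' / ea; case: b' / eb; have e : t = t' by apply/funext.
by case: t' / e t1' {et} => t1'; congr AutStar; apply: Prop_irrelevance.
Qed.

Fact star_one_subproof : (fun=> 0%R : A) (1 : F) = 0%R.
Proof. by []. Qed.
Definition star_one : aut_star :=
  @AutStar 1 1 (fun=> 0%R) star_one_subproof.

Definition star_mul_tau g h (x : F) : A :=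
  (star_tau h (star_alpha g x) + star_beta h (star_tau g x))%R.
Fact star_mul_subproof g h : star_mul_tau g h 1 = 0%R.
Proof. by rewrite /star_mul_tau loop_aut1 !star_tau1 zmod_aut0 addr0. Qed.
Definition star_mul g h : aut_star :=
  @AutStar (star_alpha g * star_alpha h) (star_beta g * star_beta h)
    (star_mul_tau g h) (star_mul_subproof g h).

Definition star_inv_tau g (x : F) : A :=
  (- (star_beta g)^-1%g (star_tau g ((star_alpha g)^-1%g x)))%R.
Fact star_inv_subproof g : star_inv_tau g 1 = 0%R.
Proof. by rewrite /star_inv_tau loop_aut1 star_tau1 zmod_aut0 oppr0. Qed.
Definition star_inv g : aut_star :=
  @AutStar (star_alpha g)^-1 (star_beta g)^-1
    (star_inv_tau g) (star_inv_subproof g).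

Fact star_mulA : associative star_mul.
Proof.
move=> g h k; apply: aut_star_inj => [||x] /=; try exact: mulgA.
by rewrite /star_mul_tau /= /star_mul_tau aut_morph addrA.
Qed.
Fact star_mul1 : left_id star_one star_mul.
Proof.
move=> g; apply: aut_star_inj => [||x] /=; try exact: mul1g.
by rewrite /star_mul_tau /= zmod_aut0 addr0.
Qed.
Fact star_mulr1 : right_id star_one star_mul.
Proof.
move=> g; apply: aut_star_inj => [||x] /=; try exact: mulg1.
by rewrite /star_mul_tau /= add0r.
Qed.
Fact star_mulV : left_inverse star_one star_inv star_mul.
Proof.
move=> g; apply: aut_star_inj => [||x] /=; try exact: mulVg.
by rewrite /star_mul_tau /= /star_inv_tau zmod_autN autVK addrN.
Qed.
Fact star_mulVr : right_inverse star_one star_inv star_mul.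
Proof.
move=> g; apply: aut_star_inj => [||x] /=; try exact: mulgV.
by rewrite /star_mul_tau /= /star_inv_tau autK addNr.
Qed.

HB.instance Definition _ := gen_eqMixin aut_star.
HB.instance Definition _ := gen_choiceMixin aut_star.
HB.instance Definition _ := isGroup.Build aut_star
  star_mulA star_mul1 star_mulr1 star_mulV star_mulVr.

Record normalized_cocycle := Cocycle {
  cocycle_fun :> F -> F -> A;
  cocycle1l : forall x, cocycle_fun 1 x = 0%R;
  cocycle1r : forall x, cocycle_fun x 1 = 0%R
}.
Implicit Types t : normalized_cocycle.

Lemma cocycle_inj (t u : normalized_cocycle) : t =2 u -> t = u.
Proof.
case: t u => [f fl fr] [f' f'l f'r] /= e.
have ff' : f = f' by apply/funext => x; apply/funext => y; apply: e.
case: f' / ff' f'l f'r {e} => f'l f'r.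
by congr Cocycle; apply: Prop_irrelevance.
Qed.

Definition cocycle_act_fun t g (x y : F) : A :=
  let a' := (star_alpha g)^-1 in let tau := star_tau g in
  (star_beta g (t (a' x) (a' y))
   + tau (a' (x * y)%g) - tau (a' x) - tau (a' y))%R.

Fact cocycle_act_subproof1l t g x : cocycle_act_fun t g 1 x = 0%R.
Proof.
rewrite /cocycle_act_fun loop_aut1 cocycle1l zmod_aut0 star_tau1 mul1g.
by rewrite add0r subr0 subrr.
Qed.
Fact cocycle_act_subproof1r t g x : cocycle_act_fun t g x 1 = 0%R.
Proof.
rewrite /cocycle_act_fun loop_aut1 cocycle1r zmod_aut0 star_tau1 mulg1.
by rewrite add0r subr0 subrr.
Qed.

Definition cocycle_act t g : normalized_cocycle :=
  Cocycle (cocycle_act_subproof1l t g) (cocycle_act_subproof1r t g).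

Lemma cocycle_act1 t : cocycle_act t 1 = t.
Proof.
by apply: cocycle_inj => x y; rewrite /= /cocycle_act_fun /= addr0 !subr0.
Qed.

Lemma cocycle_actM t g h :
  cocycle_act t (g * h) = cocycle_act (cocycle_act t g) h.
Proof.
apply: cocycle_inj => x y; rewrite /= /cocycle_act_fun /= /cocycle_act_fun.
rewrite /star_mul_tau !aut_invK !aut_morph !zmod_autN.
rewrite !aut_inv_morph !opprD -!addrA; congr (_ + _)%R.
rewrite addrCA; congr (_ + _)%R.
rewrite addrA addrCA; congr (_ + _)%R.
by rewrite [RHS]addrC !addrA.
Qed.

Definition cocycle_orbit t : set normalized_cocycle := [set cocycle_act t g | g in setT].

Definition cocycle_orbits : Type :=
  {o : set normalized_cocycle | exists t, o = cocycle_orbit t}.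

End AutStar.

Arguments aut_star : clear implicits.
Arguments normalized_cocycle : clear implicits.
Arguments cocycle_orbits : clear implicits.

(* Main.v *)
Require Import Defs.
From HB Require Import structures.
From mathcomp Require Import all_boot all_algebra.
From mathcomp Require Import boolp classical_sets functions.

(** A central extension of [F] by [A] is the same thing as [F * A] with a
    product twisted by a normalized cocycle. For a cocycle [t], the product
    [(x, a) (y, b) = (xy, a + b + t(x, y))] makes [F * A] a loop in which
    [1 * A] is a central copy of [A] with quotient [F]
    ([twisted_pair_central]). Conversely, a section [s] of the projection
    [L -> L/A = F] with [s 1 = 1] writes each element of [L] uniquely as
    [s(x) a], and centrality of [A] turns the product of [L] into the twisted
    one, where [s(x) s(y) = s(xy) t(x, y)] defines [t]
    ([central_extension_twisted]).

    It remains to see when two cocycles give isomorphic pairs. An isomorphism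
    [f] that preserves [1 * A] restricts there to an automorphism [beta] of [A],
    induces an automorphism [alpha] of [F], and is therefore of the form
    [f(x, a) = (alpha x, tau x + beta a)] with [tau 1 = 0]. Multiplicativity
    of a map of this form says precisely that [(alpha, beta, tau)] sends the
    first cocycle to the second, so isomorphism classes of twisted pairs are
    orbits ([twisted_pair_isoP]). *)

Set Implicit Arguments.
Unset Strict Implicit.
Unset Printing Implicit Defensive.

Import GRing.Theory.
Local Open Scope classical_set_scope.
Local Open Scope group_scope.

(** * Loops, isomorphisms of pairs and quotients *)

Lemma loop_mulgI (L : loopType) (x : L) : injective (fun y => x * y).
Proof. exact: bij_inj (lmul_bij x). Qed.

Lemma loop_morph1 (L M : loopType) (f : L -> M) :
  {morph f : x y / x * y} -> f 1 = 1.
Proof. by move=> fM; apply: (@loop_mulgI M (f 1)); rewrite -fM !mulg1. Qed.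

Lemma pair_iso_refl p : pair_isomorphic p p.
Proof.
exists id; split; last by rewrite image_id.
by split=> //; exists id.
Qed.

Lemma pair_iso_sym p q : pair_isomorphic p q -> pair_isomorphic q p.
Proof.
case=> f [[[g fK gK] fM] fpq]; exists g; split; first split.
- by exists f.
- by move=> x y; apply: (can_inj fK); rewrite fM !gK.
- rewrite -fpq; apply/seteqP; split=> x /=.
    by case=> _ [y py <-] <-; rewrite fK.
  by move=> px; exists (f x); [exists x | rewrite fK].
Qed.

Lemma pair_iso_trans p q r :
  pair_isomorphic p q -> pair_isomorphic q r -> pair_isomorphic p r.
Proof.
case=> f [[f_bij fM] fpq] [g [[g_bij gM] gqr]]; exists (g \o f).
split; first split.
- exact: bij_comp.
- by move=> x y /=; rewrite fM gM.
- by rewrite -image_comp fpq.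
Qed.

Lemma iso_classP p q : iso_class p = iso_class q <-> pair_isomorphic p q.
Proof.
split=> [e|pq].
  rewrite -/(iso_class p q) e; exact: pair_iso_refl.
apply/funext => r; apply/propext; split; apply: pair_iso_trans => //.
exact: pair_iso_sym.
Qed.

Lemma loop_lcoset_eqP (L : loopType) (N : subloop L) (nN : normal_subloop N)
    (x y : L) :
  loop_lcoset N x = loop_lcoset N y <-> exists2 n, subloop_set N n & y = x * n.
Proof.
split=> [e|[n Nn ->]]; last by rewrite loop_lcosetE.
by have := loop_lcoset_refl N y; rewrite -e => -[n Nn <-]; exists n.
Qed.

(** First isomorphism theorem, with the kernel replaced by the condition that
    the fibres of [pi] are the left cosets of [N]. *)
Lemma quotient_iso (L F : loopType) (N : subloop L) (nN : normal_subloop N)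
    (pi : L -> F) :
    {morph pi : x y / x * y} -> (forall z, exists x, pi x = z) ->
    (forall x y, pi x = pi y <-> exists2 n, subloop_set N n & y = x * n) ->
  exists f : loop_quotient nN -> F, loop_iso f.
Proof.
move=> piM pi_surj fibre.
pose rep (u : loop_quotient nN) := projT1 (cid (to_quotient_surj u)).
have repK u : u = to_quotient nN (rep u) by rewrite /rep; case: cid.
have rep_to x : pi (rep (to_quotient nN x)) = pi x.
  apply/(fibre _ _).2/(loop_lcoset_eqP nN).
  exact/esym/(congr1 (@coset_set _ _ _) (repK (to_quotient nN x))).
exists (pi \o rep); split.
  exists (fun z => to_quotient nN (projT1 (cid (pi_surj z)))) => [u|z] /=.
    rewrite [RHS]repK; apply: loop_quotient_inj => /=.
    by apply/(loop_lcoset_eqP nN)/(fibre _ _).1; case: cid => x /= ->.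
  by rewrite rep_to; case: cid.
move=> u v /=; rewrite -piM -[RHS]rep_to; congr (pi (rep _)).
by rewrite {1}(repK u) {1}(repK v); exact: mul_to_quotient.
Qed.

(** * The twisted product of F and A *)

Section TwistedProduct.
Context (F : loopType) (A : zmodType).
Implicit Types t u : normalized_cocycle F A.

(** An alias carrying [t], so that each cocycle gives its own loop structure
    on the same carrier. *)
Definition twisted t : Type := (F * A)%type.

HB.instance Definition _ t := Choice.on (twisted t).

Definition twisted_mul t (p q : twisted t) : twisted t :=
  (p.1 * q.1, (p.2 + q.2 + t p.1 q.1)%R).

Fact twisted_mul1 t : left_id ((1, 0%R) : twisted t) (@twisted_mul t).
Proof.
by case=> x a; rewrite /twisted_mul /= mul1g cocycle1l add0r addr0.
Qed.

Fact twisted_mulr1 t : right_id ((1, 0%R) : twisted t) (@twisted_mul t).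
Proof. by case=> x a; rewrite /twisted_mul /= mulg1 cocycle1r !addr0. Qed.

Fact twisted_lmul_bij t (p : twisted t) : bijective (fun q => twisted_mul p q).
Proof.
case: p => x a; have [g gK Kg] := lmul_bij x.
exists (fun q : twisted t => (g q.1, (q.2 - t x (g q.1) - a)%R) : twisted t).
  by case=> y b; rewrite /twisted_mul /= gK addrK addrC addKr.
by case=> y b; rewrite /twisted_mul /= Kg [(a + _)%R]addrC !subrK.
Qed.

Fact twisted_rmul_bij t (p : twisted t) : bijective (fun q => twisted_mul q p).
Proof.
case: p => x a; have [g gK Kg] := rmul_bij x.
exists (fun q : twisted t => (g q.1, (q.2 - t (g q.1) x - a)%R) : twisted t).
  by case=> y b; rewrite /twisted_mul /= gK !addrK.
by case=> y b; rewrite /twisted_mul /= Kg !subrK.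
Qed.

HB.instance Definition _ t := hasMul.Build (twisted t) (@twisted_mul t).
HB.instance Definition _ t :=
  Magma_isUMagma.Build (twisted t) (@twisted_mul1 t) (@twisted_mulr1 t).
HB.instance Definition _ t := UMagma_isLoop.Build (twisted t)
  (@twisted_lmul_bij t) (@twisted_rmul_bij t).

Lemma twisted_mulE t (x y : F) (a b : A) :
  ((x, a) : twisted t) * (y, b) = (x * y, (a + b + t x y)%R).
Proof. by []. Qed.

Definition twisted_fibre1 t : set (twisted t) := [set p | p.1 = 1].

Fact twisted_fibre1_1 t : twisted_fibre1 (1 : twisted t).
Proof. by []. Qed.

Fact twisted_fibre1_mul t (p q : twisted t) :
  twisted_fibre1 p -> twisted_fibre1 q -> twisted_fibre1 (p * q).
Proof. by rewrite /twisted_fibre1 /= => -> ->; rewrite mulg1. Qed.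

Fact twisted_fibre1_ldiv t (p q : twisted t) :
  twisted_fibre1 p -> twisted_fibre1 (p * q) -> twisted_fibre1 q.
Proof. by rewrite /twisted_fibre1 /= => ->; rewrite mul1g. Qed.

Fact twisted_fibre1_rdiv t (p q : twisted t) :
  twisted_fibre1 p -> twisted_fibre1 (q * p) -> twisted_fibre1 q.
Proof. by rewrite /twisted_fibre1 /= => ->; rewrite mulg1. Qed.

Definition twisted_sub t : subloop (twisted t) :=
  Subloop (@twisted_fibre1_1 t) (@twisted_fibre1_mul t)
    (@twisted_fibre1_ldiv t) (@twisted_fibre1_rdiv t).

Definition twisted_pair t : loop_pair := LoopPair (twisted_sub t).

(** Products with a factor [(1, a)] involve no value of the cocycle: this is
    where its normalization enters. *)
Lemma twisted_sub_central t : twisted_sub t `<=` loop_center (twisted t).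
Proof.
move=> [z c] z1 [x a] [y b]; have {z1}-> : z = 1 by exact: z1.
split; rewrite !twisted_mulE ?mul1g ?mulg1 ?cocycle1l ?cocycle1r ?addr0.
- by rewrite addrC.
- by rewrite !addrA.
- by rewrite !addrA.
- by congr pair; rewrite /= addrA [RHS]addrAC.
Qed.

Lemma twisted_pair_central t : is_central_extension F A (twisted_pair t).
Proof.
split.
  exists (fun a => (1, a) : twisted t); split; first split.
  - by [].
  - by move=> a b _ _ [].
  - by move=> [x a] x1; exists a => //; rewrite (x1 : x = 1).
  - by move=> a b; rewrite twisted_mulE mulg1 cocycle1l addr0.
exists (@twisted_sub_central t); apply: (@quotient_iso (twisted t) F (twisted_sub t) _ fst) => //.
  by move=> z; exists (z, 0%R).
case=> [x a] [y b] /=; split=> [->|[[z c] z1 [-> _]]]; last first.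
  by rewrite (z1 : z = 1) mulg1.
exists (1, (b - a)%R) => //=.
by rewrite twisted_mulE mulg1 cocycle1r addr0 addrC subrK.
Qed.

(** * Isomorphisms of twisted products *)

(** The defining equation of the action with [alpha] moved to the left and the
    signs removed: this is the second component of multiplicativity of
    [(x, a) |-> (alpha x, tau x + beta a)]. *)
Lemma cocycle_act_eqP t u (g : aut_star F A) :
  u = cocycle_act t g <-> forall x y,
    (star_tau g x + star_tau g y + u (star_alpha g x) (star_alpha g y) =
     star_tau g (x * y)%g + star_beta g (t x y))%R.
Proof.
split=> [-> x y|e].
  rewrite /= /cocycle_act_fun /= -aut_morph !aut_funK.
  by rewrite [(_ + star_tau g y)%R]addrC [LHS]addrC addrA !subrK addrC.
apply: cocycle_inj => x y; rewrite /= /cocycle_act_fun /=.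
rewrite -{1}(aut_invK (star_alpha g) x) -{1}(aut_invK (star_alpha g) y).
rewrite aut_inv_morph -addrA -opprD.
move: (aut_inv _ x) (aut_inv _ y) => {}x {}y.
by rewrite [X in (X - _)%R]addrC -e addrC addKr.
Qed.

(** The decomposition [(x, a) = (x, 0) (1, a)] determines [f] from its values
    on [F * 0] and on [1 * A]. *)
Lemma twisted_iso_triangular t u (f : twisted t -> twisted u) :
    {morph f : p q / p * q} -> (forall a, (f (1, a)).1 = 1) ->
  forall x a, f (x, a) =
    ((f (x, 0%R)).1, ((f (x, 0%R)).2 + (f (1%g, a)).2)%R).
Proof.
move=> fM f1 x a.
have {1}-> : ((x, a) : twisted t) = ((x, 0%R) : twisted t) * (1, a).
  by rewrite twisted_mulE mulg1 cocycle1r addr0 add0r.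
rewrite fM; move: (f1 a).
case: (f (1, a)) => z b /= ->; case: (f (x, 0%R)) => y c.
by rewrite twisted_mulE mulg1 cocycle1r addr0.
Qed.

(** The maps [alpha], [beta] and [tau] are read off from [f] on [F * 0] and on
    [1 * A]. The inverse of [f] is triangular for the same reason as [f], so
    its diagonal entries invert [alpha] and [beta]. *)
Lemma twisted_iso_act t u (f : twisted t -> twisted u) :
    loop_iso f -> f @` twisted_sub t = twisted_sub u ->
  exists g, u = cocycle_act t g.
Proof.
move=> [[f' fK f'K] fM] ef.
have f'M : {morph f' : p q / p * q}.
  by move=> p q; apply: (can_inj fK); rewrite fM !f'K.
have f1 a : (f (1, a)).1 = 1.
  have : subloop_set (twisted_sub u) (f (1, a)) by rewrite -ef; exists (1, a).
  by [].
have f'1 a : (f' (1, a)).1 = 1.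
  have : subloop_set (twisted_sub u) (1, a) by [].
  by rewrite -ef => -[p /= p1 <-]; rewrite fK.
have fE := twisted_iso_triangular fM f1.
have f'E := twisted_iso_triangular f'M f'1.
pose al x := (f (x, 0%R)).1; pose al' x := (f' (x, 0%R)).1.
pose be a := (f (1, a)).2; pose be' a := (f' (1, a)).2.
have alK : cancel al al'.
  move=> x; rewrite /al' /al.
  have := fK (x, 0%R); case: (f (x, 0%R)) => y b /=.
  by rewrite f'E => -[].
have al'K : cancel al' al.
  move=> x; rewrite /al' /al.
  have := f'K (x, 0%R); case: (f' (x, 0%R)) => y b /=.
  by rewrite fE => -[].
have beK : cancel be be'.
  move=> a; rewrite /be' /be.
  have := fK (1, a); move: (f1 a); case: (f (1, a)) => y b /= -> e.
  by rewrite e.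
have be'K : cancel be' be.
  move=> a; rewrite /be' /be.
  have := f'K (1, a); move: (f'1 a); case: (f' (1, a)) => y b /= -> e.
  by rewrite e.
have alM : {morph al : x y / x * y}.
  move=> x y; have := fM (x, 0%R) (y, 0%R).
  by rewrite twisted_mulE fE => /(congr1 fst).
have beM : {morph be : a b / (a + b)%R}.
  move=> a b; have := fM (1, a) (1, b).
  rewrite twisted_mulE mulg1 cocycle1l addr0 => /(congr1 snd) /= e.
  by rewrite /be e /= !f1 cocycle1l addr0.
have f0 : f (1, 0%R) = (1, 0%R) by exact: (loop_morph1 fM).
have ta1 : (f (1, 0%R)).2 = 0%R by rewrite f0.
pose g : aut_star F A := @AutStar F A (Automorphism alK al'K alM)
  (Automorphism beK be'K beM) (fun x => (f (x, 0%R)).2) ta1.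
exists g; apply/cocycle_act_eqP => x y /=.
have := fM (x, 0%R) (y, 0%R).
rewrite twisted_mulE addr0 add0r (fE _ (t x y)) => /(congr1 snd) /=.
exact: esym.
Qed.

Lemma act_twisted_iso t u (g : aut_star F A) :
  u = cocycle_act t g -> pair_isomorphic (twisted_pair t) (twisted_pair u).
Proof.
move=> /cocycle_act_eqP e.
pose al := star_alpha g; pose be := star_beta g; pose ta := star_tau g.
exists (fun p : twisted t => (al p.1, (ta p.1 + be p.2)%R) : twisted u).
split; first split.
- exists (fun p : twisted u =>
    (aut_inv al p.1, aut_inv be (p.2 - ta (aut_inv al p.1))%R) : twisted t).
    by case=> x a /=; rewrite !aut_funK [(ta x + _)%R]addrC addrK aut_funK.
  by case=> x a /=; rewrite !aut_invK addrC subrK.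
- case=> x a [y b]; rewrite twisted_mulE /= twisted_mulE /= aut_morph.
  congr pair; rewrite !aut_morph [X in _ = (X + _)%R]addrACA [RHS]addrAC e.
  by rewrite -[RHS]addrA; congr (_ + _)%R; rewrite addrC.
- apply/seteqP; split=> -[x a] /=.
    by case=> -[y b] y1 [<- _]; rewrite (y1 : y = 1); exact: loop_aut1.
  move=> x1; rewrite (x1 : x = 1); exists (1, aut_inv be a) => //=.
  by rewrite loop_aut1 /ta star_tau1 add0r aut_invK.
Qed.

Lemma twisted_pair_isoP t u :
  pair_isomorphic (twisted_pair t) (twisted_pair u) <->
  exists g, u = cocycle_act t g.
Proof.
split=> [[f [f_iso ef]]|[g]]; last exact: act_twisted_iso.
exact: twisted_iso_act f_iso ef.
Qed.

Lemma cocycle_orbit_eqP t u :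
  cocycle_orbit t = cocycle_orbit u <-> exists g, u = cocycle_act t g.
Proof.
split=> [e|[g ->]].
  have : cocycle_orbit u u by exists 1 => //; exact: cocycle_act1.
  by rewrite -e => -[g _ <-]; exists g.
apply/seteqP; split=> _ [h _ <-].
  by exists (g^-1 * h) => //; rewrite -cocycle_actM mulgA mulgV mul1g.
by exists (g * h) => //; rewrite cocycle_actM.
Qed.

(** * Every central extension is a twisted product *)

(** The cocycle measures the failure of a section of [L -> F] to be
    multiplicative. It is normalized because the section sends [1] to [1]. *)
Lemma central_extension_twisted p :
  is_central_extension F A p -> exists t, pair_isomorphic (twisted_pair t) p.
Proof.
case: p => L S [] /= [i [[iS i_inj i_surj] iM]] [cS [f [[f' fK f'K] fM]]].
pose nS := central_normal cS.
pose pi (x : L) := f (to_quotient nS x).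
have piM : {morph pi : x y / x * y}.
  by move=> x y; rewrite /pi -mul_to_quotient fM.
have pi_surj z : exists x, pi x = z.
  have [x e] := to_quotient_surj (f' z).
  by exists x; rewrite /pi -e f'K.
have fibre x y : pi x = pi y <-> exists a, y = x * i a.
  split=> [/(can_inj fK)/(congr1 (@coset_set _ _ _)) e|[a ->]].
    have [n Sn ->] := (loop_lcoset_eqP nS _ _).1 e.
    by have [a _ <-] := i_surj n Sn; exists a.
  congr f; apply/loop_quotient_inj/(loop_lcoset_eqP nS).
  by exists (i a) => //; apply: iS.
have iC a x y : [/\ i a * x = x * i a, i a * (x * y) = i a * x * y,
    x * (i a * y) = x * i a * y & x * (y * i a) = x * y * i a].
  exact: cS (iS a I) x y.
have i0 : i 0%R = 1.
  by apply: (@loop_mulgI L (i 0%R)); rewrite -iM addr0 mulg1.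
(* An arbitrary section is corrected at 1. *)
have [s sK s1] : exists2 s : F -> L, cancel s pi & s 1 = 1.
  have pi1 : pi 1 = 1 by exact: loop_morph1 piM.
  pose s z := if z == 1 then 1 else projT1 (cid (pi_surj z)).
  exists s; last by rewrite /s eqxx.
  by move=> z; rewrite /s; case: eqP => [->|_] //; case: cid.
have defect x y : exists a, s x * s y = s (x * y) * i a.
  by apply/fibre; rewrite piM !sK.
pose t x y := projT1 (cid (defect x y)).
have tE x y : s x * s y = s (x * y) * i (t x y) by rewrite /t; case: cid.
have si_inj x a y b : s x * i a = s y * i b -> x = y /\ a = b.
  move=> e; have exy : x = y.
    rewrite -(sK x) -(sK y).
    rewrite ((fibre _ _).2 (ex_intro _ a (erefl (s x * i a)))) e.
    by apply/esym/fibre; exists b.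
  split=> //; move: e; rewrite exy => /loop_mulgI.
  by apply: i_inj; rewrite inE.
have t1l x : t 1 x = 0%R.
  by have := tE 1 x; rewrite s1 !mul1g -{1}[s x]mulg1 -i0 => /si_inj[].
have t1r x : t x 1 = 0%R.
  by have := tE x 1; rewrite s1 !mulg1 -{1}[s x]mulg1 -i0 => /si_inj[].
pose tc := @Cocycle F A t t1l t1r.
exists tc, (fun p : twisted tc => s p.1 * i p.2); split; first split.
- have si_surj z : exists p : twisted tc, s p.1 * i p.2 = z.
    have [a ->] : exists a, z = s (pi z) * i a by apply/fibre; rewrite sK.
    by exists (pi z, a).
  exists (fun z => projT1 (cid (si_surj z))) => [[x a]|z]; case: cid => //=.
  by case=> y b /= /si_inj[-> ->].
(* Centrality moves [i a] past [s y * i b]: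
     s x i a * (s y i b) = s x * (s y i (b + a)) = (s x * s y) i (b + a). *)
- case=> x a [y b] /=; have [_ _ <- _] := iC a (s x) (s y * i b).
  have [-> _ _ _] := iC a (s y * i b) 1; have [_ _ _ <-] := iC a (s y) (i b).
  rewrite -iM; have [_ _ _ ->] := iC (b + a)%R (s x) (s y).
  have [_ _ _] := iC (b + a)%R (s (x * y)) (i (t x y)).
  by rewrite tE => <-; rewrite -iM addrC [(b + a)%R]addrC.
- apply/seteqP; split=> z /=.
    by case=> -[x a] x1 <-; rewrite /= (x1 : x = 1) s1 mul1g; apply: iS.
  move=> /i_surj[a _ <-]; exists (1, a) => //=.
  by rewrite s1 mul1g.
Qed.

End TwistedProduct.

(** * Classes of pairs and orbits *)

(** Both sides are images of the set of cocycles, under [t |-> [F *_t A, A]]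
    and [t |-> orbit of t], and these two maps have the same fibres; the
    bijection sends a class to the orbit of any cocycle representing it. *)
Theorem theorem4p8 (F : loopType) (A : zmodType) :
  exists f : Q F A -> cocycle_orbits F A, bijective f.
Proof.
have choose_t (c : Q F A) : exists t : normalized_cocycle F A,
    sval c = iso_class (twisted_pair t).
  case: c => c [p [/= /central_extension_twisted[t tp] ->]].
  by exists t; apply/iso_classP/pair_iso_sym.
pose t c := projT1 (cid (choose_t c)).
have tE c : sval c = iso_class (twisted_pair (t c)) by rewrite /t; case: cid.
have class_orbit (u v : normalized_cocycle F A) :
    iso_class (twisted_pair u) = iso_class (twisted_pair v) <->
    cocycle_orbit u = cocycle_orbit v.
  by split=> [/iso_classP/twisted_pair_isoP/cocycle_orbit_eqP|
    /cocycle_orbit_eqP/twisted_pair_isoP/iso_classP].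
pose class u : Q F A :=
  exist _ _ (ex_intro _ (twisted_pair u) (conj (twisted_pair_central u) erefl)).
pose orbit u : cocycle_orbits F A := exist _ _ (ex_intro _ u erefl).
have rep_orbit (o : cocycle_orbits F A) : exists u, sval o = cocycle_orbit u.
  exact: svalP o.
exists (orbit \o t), (fun o => class (projT1 (cid (rep_orbit o)))).
  move=> c; apply: eq_sig_hprop => /= [*|]; first exact: Prop_irrelevance.
  rewrite tE; apply/class_orbit.
  by case: cid => u /= ->.
move=> o; apply: eq_sig_hprop => /= [*|]; first exact: Prop_irrelevance.
case: cid => u /= ->.
by apply/class_orbit; rewrite -tE.
Qed.
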